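(* Let $\{X_n\}_{n\in\mathbb Z}$ be a stationary and ergodic Markov chain of order $K$ with values in a finite or countably infinite alphabet $\mathcal X$, let $0<\gamma<1$, and let $ORDEST_n$ be an estimator of the order, computed from $X_0^n$, which equals the order $K$ eventually almost surely. Let $\mathcal N$ be the random set of those $n$ for which the string $X_{n-ORDEST_n+1}^n$ appears at least $n^{1-\gamma}$ times in $X_0^n$, and for $x\in\mathcal X$ let $$\hat q_n(x)=\frac{\#\{ORDEST_n-1\le i<n: X_{i-ORDEST_n+1}^i=X_{n-ORDEST_n+1}^n,\ X_{i+1}=x\}}{\#\{ORDEST_n-1\le i<n: X_{i-ORDEST_n+1}^i=X_{n-ORDEST_n+1}^n\}}.$$ Then for each $x\in\mathcal X$, along $n\in\mathcal N$, $$\left|\hat q_n(x)-P(X_{n+1}=x\mid X_{n-K}^n)\right|\to0\quad\text{almost surely,}$$ and, almost surely, $$\liminf_{n\to\infty}\frac{|\mathcal N\cap\{0,1,\dots,n-1\}|}{n}=1.$$ If the Markov chain takes values in a finite set, then almost surely $\mathcal N$ contains all but finitely many positive integers.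
   Context: Notation: $X_m^n=(X_m,\dots,X_n)$ for $m\le n$, and $X_m^n$ is the empty string if $m>n$. *)

(* Defs.v *)
From mathcomp Require Import all_boot all_order all_algebra.
From mathcomp Require Import all_classical all_reals all_analysis.

Set Implicit Arguments.
Unset Strict Implicit.
Unset Printing Implicit Defensive.

Import Order.TTheory GRing.Theory Num.Theory.
Import numFieldNormedType.Exports.

Local Open Scope classical_set_scope.
Local Open Scope ring_scope.

(* The integers m, m + 1, ..., n in this order; empty when m > n. *)
Definition zrange (m n : int) : seq int :=
  if m <= n then [seq m + j%:Z | j <- iota 0 `|n - m|%N.+1] else [::].

Section Strings.
Context {T : Type} {A : countType}.
Implicit Types (X : int -> T -> A) (m n : int) (w : T) (L : nat).

(* X_m^n *)
Definition str X m n w : seq A := [seq X i w | i <- zrange m n].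

(* i is the last index of an occurrence of X_{n-L+1}^n *)
Definition matches X L n w (i : int) : bool :=
  str X (i - L%:Z + 1) i w == str X (n - L%:Z + 1) n w.

(* The number of occurrences of X_{n-L+1}^n in X_0^n, the one ending at n
   included. An occurrence ending at i starts at i - L + 1 >= 0; the empty
   string (L = 0) occurs with ends -1, 0, ..., n. *)
Definition occurrences X L (n : nat) w : nat :=
  count (matches X L n%:Z w) (zrange (L%:Z - 1) n%:Z).

(* The number of those occurrences that end strictly before n. *)
Definition past_occurrences X L (n : nat) w : nat :=
  count (matches X L n%:Z w) (zrange (L%:Z - 1) (n%:Z - 1)).

(* The number of those past occurrences that are followed by the letter x. *)
Definition successor_occurrences X L (n : nat) w (x : A) : nat :=
  count (fun i => matches X L n%:Z w i && (X (i + 1) w == x))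
    (zrange (L%:Z - 1) (n%:Z - 1)).

Definition path_of X w : int -> A := X ^~ w.

End Strings.

Section Sequences.
Context {A : countType}.

(* The product sigma-algebra on A^Z, A being discrete. *)
Definition sequence_events : set (set (int -> A)) :=
  <<s [set B | exists i (C : set A), B = [set f | C (f i)]] >>.

Definition shift (f : int -> A) : int -> A := fun n => f (n + 1).

End Sequences.

Section Processes.
Context {d : measure_display} {T : measurableType d} {R : realType}.
Variable P : probability T R.
Context {A : countType}.
Implicit Types (X : int -> T -> A).

(* A carries the discrete sigma-algebra. *)
Definition process X : Prop :=
  forall n (C : set A), measurable (X n @^-1` C).

Definition stationary X : Prop :=
  forall B, sequence_events B ->
    P [set w | B (shift (path_of X w))] = P [set w | B (path_of X w)].

Definition ergodic X : Prop :=
  forall B, sequence_events B -> shift @^-1` B = B ->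
    P [set w | B (path_of X w)] = 0%E \/ P [set w | B (path_of X w)] = 1%E.

(* P (E | F), with value 0 when P F = 0 *)
Definition cprob (E F : set T) : R := fine (P (E `&` F)) / fine (P F).

(* The next letter depends on the finite past only through its last k letters:
   z is the value of these, u that of an arbitrarily long string before them. *)
Definition markov_property X (k : nat) : Prop :=
  forall (n : int) (u z : seq A) (x : A), size z = k ->
    let past := [set w | str X (n - (size (u ++ z))%:Z + 1) n w = u ++ z] in
    (0 < P past)%E ->
    cprob [set w | X (n + 1) w = x] past =
    cprob [set w | X (n + 1) w = x] [set w | str X (n - k%:Z + 1) n w = z].

(* The order is the least k for which the Markov property holds. *)
Definition markov_of_order X (K : nat) : Prop :=
  markov_property X K /\ forall k, markov_property X k -> (K <= k)%N.

(* P (X_{n+1} = x | X_{n-K}^n), as a random variable *)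
Definition next_letter_prob X (K n : nat) (x : A) (w : T) : R :=
  cprob [set w' | X (n%:Z + 1) w' = x]
        [set w' | str X (n%:Z - K%:Z) n%:Z w' = str X (n%:Z - K%:Z) n%:Z w].

End Processes.

Section Estimation.
Context {T : Type} {R : realType} {A : countType}.
Implicit Types (X : int -> T -> A) (n : nat) (w : T).

(* An estimator is a function of the observed string; the time n is determined
   by the length n + 1 of X_0^n. *)
Variable ordest : seq A -> nat.

Definition ordest_at X n w : nat := ordest (str X 0 n%:Z w).

Definition good_time X (gamma : R) n w : bool :=
  n%:R `^ (1 - gamma) <= (occurrences X (ordest_at X n w) n w)%:R.

Definition good_times X (gamma : R) w : set nat :=
  [set n | good_time X gamma n w].

Definition q_hat X n (x : A) w : R :=
  (successor_occurrences X (ordest_at X n w) n w x)%:R /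
  (past_occurrences X (ordest_at X n w) n w)%:R.

End Estimation.

(* Main.v *)
Require Import Defs.
From mathcomp Require Import all_boot all_order all_algebra.
From mathcomp Require Import all_classical all_reals all_analysis.
From mathcomp Require Import measurable_realfun.
From mathcomp Require Import zify lra ring.
Import Order.TTheory GRing.Theory Num.Theory.
Import numFieldNormedType.Exports.
Local Open Scope classical_set_scope.
Local Open Scope ring_scope.
Set Implicit Arguments.
Unset Strict Implicit.
Unset Printing Implicit Defensive.

Local Notation shift := (@Defs.shift _).

(** Write z for the last K letters X_(n-K+1)^n and p(x | z) for the transition
    probability. Two estimates on the counts of words in X_0^n carry the proof.

    Exponential concentration. Fix z and a time j at which z has just been
    read. Among the later occurrences of z, the number of those followed by x,
    minus p(x | z) times their number N, is a martingale with bounded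
    increments that only moves at the occurrences of z. Hence it exceeds e N
    while N >= M with probability at most exp (- e^2 M / 8), up to a factor 2
    for the two signs, and this bound is conditional on z being read at j
    (walk_tail, law_deviates_word), hence uniform over the countably many z.
    The word z read at time n is itself random, but it has a first occurrence
    in the observation, at one of at most n + 1 places j, and counting from
    that j loses nothing (deviates_first_hit). At a good time
    M = n^(1 - gamma) - 1, and (n + 1) exp (- c n^(1 - gamma)) is summable, so
    that by Borel-Cantelli only finitely many good times deviate by more than
    e (deviates_eventually_not). This is the convergence of the estimator,
    because almost surely the order estimator is eventually K and
    P (X_(n+1) = x | X_(n-K)^n) is p(x | z).

    Linear frequencies. By ergodicity the visits to an event B have lower
    frequency at least P B (visits_ge_eventually). So every word of positive
    probability occurs linearly often, which beats n^(1 - gamma), and no word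
    of probability zero ever occurs (word_gt0_ae): for a finite set s of words,
    all late times at which the last K letters belong to s are good
    (frequent_words). Over a finite alphabet s can contain all words of length
    K; in general s can be chosen with probability at least 1 - e, and then
    the times spent in s have lower density at least 1 - e. *)

(** * Events of the sequence space *)

Section SequenceEvents.
Context {A : countType}.
Implicit Types (B : set (int -> A)) (f : int -> A).

Lemma sequence_events0 : sequence_events (@set0 (int -> A)).
Proof. exact: (@sigma_algebra0 _ setT). Qed.

Lemma sequence_eventsC B : sequence_events B -> sequence_events (~` B).
Proof. by move=> mB; rewrite -setTD; exact: (@sigma_algebraCD _ setT). Qed.

Lemma sequence_eventsT : sequence_events [set: int -> A].
Proof. by rewrite -setC0; exact: sequence_eventsC sequence_events0. Qed.

Lemma sequence_events_bigcup (F : nat -> set (int -> A)) :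
  (forall i, sequence_events (F i)) -> sequence_events (\bigcup_i F i).
Proof. exact: (@sigma_algebra_bigcup _ setT). Qed.

Lemma sequence_events_bigcap (F : nat -> set (int -> A)) :
  (forall i, sequence_events (F i)) -> sequence_events (\bigcap_i F i).
Proof.
move=> mF; rewrite -[X in sequence_events X]setCK setC_bigcap.
by apply: sequence_eventsC; apply: sequence_events_bigcup => i;
  exact: sequence_eventsC.
Qed.

Lemma sequence_eventsU B1 B2 :
  sequence_events B1 -> sequence_events B2 -> sequence_events (B1 `|` B2).
Proof.
move=> m1 m2; rewrite -bigcup2E; apply: sequence_events_bigcup.
by move=> [|[|i]] //=; exact: sequence_events0.
Qed.

Lemma sequence_eventsI B1 B2 :
  sequence_events B1 -> sequence_events B2 -> sequence_events (B1 `&` B2).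
Proof.
move=> m1 m2; rewrite -[X in sequence_events X]setCK setCI.
by apply: sequence_eventsC; apply: sequence_eventsU; exact: sequence_eventsC.
Qed.

Lemma sequence_events_shift B :
  sequence_events B -> sequence_events (shift @^-1` B).
Proof.
suff: @sequence_events A `<=` [set B | sequence_events (shift @^-1` B)]
  by apply.
apply: smallest_sub; first split=> [|B0|F mF] /=.
- by rewrite preimage_set0; exact: sequence_events0.
- by move=> mB; rewrite setTD preimage_setC; exact: sequence_eventsC.
- by rewrite preimage_bigcup; exact: sequence_events_bigcup.
by move=> _ [i [C ->]]; apply: sub_sigma_algebra; exists (i + 1), C.
Qed.

(** The values of an alphabet-valued coordinate are countably many, hence an
    event that looks at finitely many coordinates is a countable union of
    cylinders. *)
Lemma sequence_events_coordinates (s : seq int) B :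
  (forall f g, {in s, f =1 g} -> B f -> B g) -> sequence_events B.
Proof.
move=> dB; pose Q := [set v | exists2 f, B f & [seq f i | i <- s] = v].
have -> : B = [set f | Q [seq f i | i <- s]].
  apply/seteqP; split=> f /= => [Bf|[g Bg gf]]; first by exists f.
  by apply: dB Bg => i si; move/eq_in_map: gf => ->.
move: Q => {dB B}; elim: s => [|a s IHs] Q.
  have [Q0|Q0] := pselect (Q [::]).
    rewrite (_ : [set f | _] = setT); last by apply/seteqP; split.
    exact: sequence_eventsT.
  rewrite (_ : [set f | _] = set0); first exact: sequence_events0.
  by apply/seteqP; split.
pose F n : set (int -> A) := if @unpickle A n is Some x then
  [set f | f a = x] `&` [set f | Q (x :: [seq f i | i <- s])] else set0.
have -> : [set f | Q [seq f i | i <- a :: s]] = \bigcup_n F n.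
  apply/seteqP; split=> f /= => [Qf|[n _]].
    by exists (pickle (f a)) => //; rewrite /F pickleK.
  by rewrite /F; case: unpickle => //= x [<-].
apply: sequence_events_bigcup => n; rewrite /F.
case: unpickle => [x|]; last exact: sequence_events0.
apply: sequence_eventsI; last exact: (IHs (fun v => Q (x :: v))).
by apply: sub_sigma_algebra; exists a, [set x].
Qed.

End SequenceEvents.

(** * An ergodic theorem for frequencies *)

Section Visits.
Context {A : countType}.
Implicit Types (B : set (int -> A)) (f : int -> A).

Definition visits B n f : nat := (\sum_(i < n) (iter i shift f \in B))%N.

Lemma visitsS B n f : visits B n.+1 f = ((f \in B) + visits B n (shift f))%N.
Proof.
by rewrite /visits big_ord_recl /=; congr addn; under [RHS]eq_bigr do
  rewrite -iterSr.
Qed.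

Lemma visits_add B m n f :
  visits B (m + n) f = (visits B m f + visits B n (iter m shift f))%N.
Proof.
elim: m f => [|m IHm] f; first by rewrite /visits big_ord0.
by rewrite addSn !visitsS IHm addnA iterSr.
Qed.

Lemma visits_sub B B' n f :
  B `<=` B' -> (visits B n f <= visits B' n f)%N.
Proof.
move=> BB'; apply: leq_sum => i _; case: (boolP (_ \in B)) => // /set_mem/BB'.
by move=> /mem_set ->.
Qed.

Lemma visitsC B n f : (visits B n f + visits (~` B) n f)%N = n.
Proof.
elim: n f => [|n IHn] f; first by rewrite /visits !big_ord0.
by rewrite !visitsS addnACA IHn in_setC; case: (f \in B).
Qed.

Lemma sequence_events_visits B n (Q : set nat) :
  sequence_events B -> sequence_events [set f | Q (visits B n f)].
Proof.
move=> mB; elim: n Q => [|n IHn] Q.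
  apply: (@sequence_events_coordinates _ [::]) => f g _.
  by rewrite /= /visits !big_ord0.
have -> : [set f | Q (visits B n.+1 f)] =
   (B `&` (shift @^-1` [set f | Q (visits B n f).+1])) `|`
   (~` B `&` (shift @^-1` [set f | Q (visits B n f)])).
  apply/seteqP; split=> f /=; rewrite visitsS.
    by case: (boolP (f \in B)) => [/set_mem|/negP fB]; [left|right; split=> //;
      move/mem_set].
  by case=> -[]; [move/mem_set ->|move=> fB; case: (boolP (f \in B)) =>
    [/set_mem|]].
apply: sequence_eventsU; apply: sequence_eventsI => //.
- exact: sequence_events_shift (IHn (fun k => Q k.+1)).
- exact: sequence_eventsC.
- exact: sequence_events_shift (IHn _).
Qed.

(** Cut [0, L) into blocks: where some n <= M sees at least r n visits to B,
    the block has that length n; elsewhere it has length 1, and its only time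
    counts as a visit. Only the last M times may fail to fill a block. *)
Lemma visits_blocks (R : realType) (r : R) B M L f : 0 <= r -> r <= 1 ->
  r * (L%:R - M%:R) <= (visits (B `|` [set g | forall n, (0 < n <= M)%N ->
    (visits B n g)%:R < r * n%:R]) L f)%:R.
Proof.
move=> r0 r1; set D := [set g | _].
elim/ltn_ind: L f => L IHL f; have [LM|ML] := leqP L M.
  by apply: le_trans (ler0n _ _); rewrite mulr_ge0_le0// subr_le0 ler_nat.
have [Df|nDf] := pselect (D f).
  case: L ML IHL => // L ML IHL; rewrite visitsS mem_set; last by right.
  rewrite natrD -natr1 [true%:R]/=; have := IHL L (ltnSn L) (shift f).
  by rewrite !mulrBr mulrDr mulr1; lra.
have [n /andP[n0 nM] nf] :
    exists2 n, (0 < n <= M)%N & r * n%:R <= (visits B n f)%:R.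
  apply: contrapT => h; apply: nDf => n nM; rewrite ltNge; apply/negP => h'.
  by apply: h; exists n.
have /subnKC {1 2}<- : (n <= L)%N by lia.
rewrite visits_add !natrD.
have := IHL (L - n)%N ltac:(lia) (iter n shift f).
have : (visits B n f)%:R <= (visits (B `|` D) n f)%:R :> R.
  by rewrite ler_nat; apply: visits_sub; left.
by lra.
Qed.

End Visits.

Section Ergodic.
Context {d : measure_display} {T : measurableType d} {R : realType}.
Variable P : probability T R.
Context {A : countType}.
Variable X : int -> T -> A.
Hypothesis X_process : process X.
Implicit Types (B : set (int -> A)).

Lemma measurable_path B :
  sequence_events B -> measurable [set w | B (path_of X w)].
Proof.
suff: @sequence_events A `<=` [set B | measurable [set w | B (path_of X w)]]
  by apply.
apply: smallest_sub; first split=> [|B0|F mF] /=.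
  - by rewrite (_ : [set _ | _] = set0).
  - by move=> /measurableC; rewrite (_ : ~` _ =
      [set w | (setT `\` B0) (path_of X w)])//; apply/seteqP; split=> // w [].
  - rewrite (_ : [set _ | _] = \bigcup_i [set w | F i (path_of X w)])//.
    exact: bigcupT_measurable.
by move=> _ [i [C ->]]; exact: X_process.
Qed.

Hypothesis X_stationary : stationary P X.

Lemma stationary_iter B i : sequence_events B ->
  P [set w | B (iter i shift (path_of X w))] = P [set w | B (path_of X w)].
Proof.
elim: i B => [//|i IHi] B mB; rewrite -X_stationary//.
rewrite -(IHi (shift @^-1` B)); last exact: sequence_events_shift.
by congr (P _).
Qed.

(** Stationarity gives each time the same probability of a visit. *)
Lemma expected_visits_ge B n (c : R) : sequence_events B -> 0 <= c ->
  (forall f, c <= (visits B n f)%:R) ->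
  c <= n%:R * fine (P [set w | B (path_of X w)]).
Proof.
move=> mB c0 cB; pose E (i : nat) := [set w | B (iter i shift (path_of X w))].
have mBi i : sequence_events (iter i (preimage shift) B).
  by elim: i => //= i; exact: sequence_events_shift.
have mE i : measurable (E i).
  rewrite (_ : E i = [set w | iter i (preimage shift) B (path_of X w)]).
    exact: measurable_path.
  apply/seteqP; split=> w; rewrite /E /=.
    by elim: i (path_of X w) => //= i IHi f; rewrite -iterS iterSr => /IHi.
  by elim: i (path_of X w) => //= i IHi f /IHi; rewrite -iterS iterSr.
have PE i : P (E i) = P [set w | B (path_of X w)] by exact: stationary_iter.
rewrite -lee_fin EFinM fineK; last exact: fin_num_measure (measurable_path mB).
have <- : (\int[P]_w (\sum_(i < n) (\1_(E i) w)%:E) =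
    n%:R%:E * P [set w | B (path_of X w)])%E.
  rewrite ge0_integral_sum//; first last.
    by move=> i; apply/measurable_EFinP; exact: measurable_indic.
  rewrite (eq_bigr (fun=> P [set w | B (path_of X w)])); last first.
    by move=> i _; rewrite integral_indic// setIT; exact: PE.
  by rewrite sumr_const card_ord mule_natl.
have -> : c%:E = (\int[P]_w (cst c%:E w))%E.
  by rewrite integral_cst// [X in (_ * X)%E](_ : _ = 1%E) ?mule1//;
    exact: probability_setT.
apply: ge0_le_integral => //.
- apply: emeasurable_sum => i; apply/measurable_EFinP; exact: measurable_indic.
- move=> w _; rewrite sumEFin lee_fin (le_trans (cB (path_of X w)))//.
  by rewrite /visits natr_sum ler_sum.
Qed.

End Ergodic.

Section Frequencies.
Context {d : measure_display} {T : measurableType d} {R : realType}.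
Variable P : probability T R.
Context {A : countType}.
Variable X : int -> T -> A.
Hypothesis X_process : process X.
Hypothesis X_stationary : stationary P X.
Implicit Types (B : set (int -> A)).

Let mp := measurable_path X_process.

Let fin_path B : sequence_events B ->
  P [set w | B (path_of X w)] \is a fin_num.
Proof. by move=> mB; apply: fin_num_measure; exact: mp. Qed.

(** When almost every path sees r n visits in [0, n) for some n > 0, all but a
    few paths see them for some n <= M. Declaring the exceptional times to be
    visits, visits_blocks gives r (L - M) visits in [0, L) on every path;
    taking expectations, then L and M to infinity, yields the bound. *)
Lemma maximal_visits B (r : R) : sequence_events B -> 0 <= r -> r <= 1 ->
  P [set w | forall n, (0 < n)%N ->
    (visits B n (path_of X w))%:R < r * n%:R] = 0%E ->
  r <= fine (P [set w | B (path_of X w)]).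
Proof.
move=> mB r0 r1 P0; pose D M := [set f : int -> A | forall n, (0 < n <= M)%N ->
  (visits B n f)%:R < r * n%:R].
have mD M : sequence_events (D M).
  rewrite (_ : D M = \bigcap_n [set f | (0 < n <= M)%N ->
    (visits B n f)%:R < r * n%:R]).
    apply: sequence_events_bigcap => n.
    exact: (sequence_events_visits n
      [set k | (0 < n <= M)%N -> k%:R < r * n%:R]).
  by apply/seteqP; split=> f Df n => [_|]; exact: Df.
have rM M : r <= fine (P [set w | (B `|` D M) (path_of X w)]).
  set p := fine _; rewrite leNgt; apply/negP => pr.
  pose L := (Num.truncn (r * M%:R / (r - p))).+1.
  have LE : r * M%:R < L%:R * (r - p).
    by rewrite -ltr_pdivrMr ?subr_gt0// /L truncnS_gt.
  have ML : (M <= L)%N.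
    rewrite -(ler_nat R) leNgt; apply/negP => LM.
    have : L%:R * (r - p) <= M%:R * (r - p) by rewrite ler_wpM2r ?ltW// subr_gt0.
    have : 0 <= M%:R * p by rewrite mulr_ge0// fine_ge0.
    by lra.
  have := @expected_visits_ge _ _ _ P _ _ X_process X_stationary (B `|` D M) L
    (r * (L%:R - M%:R)) (sequence_eventsU mB (mD M)).
  rewrite -/p mulr_ge0 ?subr_ge0 ?ler_nat// => /(_ isT) h.
  have {h} := h (fun f => visits_blocks B M L f r0 r1).
  by lra.
have cD : (fun M => fine (P [set w | D M (path_of X w)])) @ \oo --> (0 : R).
  apply: fine_cvg; have mDM M : measurable [set w | D M (path_of X w)] by exact: mp.
  rewrite -[X in _ --> X]P0.
  rewrite [X in _ --> P X](_ : _ = \bigcap_M [set w | D M (path_of X w)]).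
    apply: nonincreasing_cvg_mu => //.
    - by rewrite ltey_eq fin_path.
    - exact: bigcapT_measurable.
    - move=> m n mn; apply/subsetPset => w /= Dw k /andP[k0 km].
      by apply: Dw; rewrite k0 (leq_trans km).
  apply/seteqP; split=> w /= Dw => [M _ n /andP[n0 _]|n n0]; first exact: Dw.
  by apply: (Dw n) => //; rewrite n0 leqnn.
apply/ler_addgt0Pr => e e0.
have [M _ /(_ M (leqnn M)) /= DM] := cvgr_lt _ cD _ e0.
apply: le_trans (rM M) _; apply: le_trans (_ : _ <= fine
   (P [set w | B (path_of X w)]) + fine (P [set w | D M (path_of X w)])) _.
  rewrite -fineD ?fin_path// fine_le ?fin_path//.
  - exact: sequence_eventsU.
  - by rewrite fin_numD !fin_path.
  - exact: (@measureU2 _ _ _ P [set w | B (path_of X w)]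
      [set w | D M (path_of X w)] (mp mB) (mp (mD M))).
by rewrite lerD2l ltW.
Qed.

Hypothesis X_ergodic : ergodic P X.

(** Let U say that the excess of the visits over r n is unbounded. A shift
    changes the excess by a bounded amount, so U is invariant, exactly and not
    only up to null sets. If U had probability 1 then almost every path would
    see r n visits for some n > 0, against maximal_visits. *)
Lemma visits_lt_eventually B (r s : R) : sequence_events B ->
  fine (P [set w | B (path_of X w)]) < r -> r <= 1 -> r < s ->
  \forall w \ae P, \forall n \near \oo,
    (visits B n (path_of X w))%:R <= s * n%:R.
Proof.
move=> mB Pr r1 rs.
have r0 : 0 <= r by rewrite (le_trans _ (ltW Pr))// fine_ge0.
pose U := [set f : int -> A |
  forall c, exists n, r * n%:R + c%:R <= (visits B n f)%:R].
have mU : sequence_events U.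
  rewrite (_ : U = \bigcap_c \bigcup_n
     [set f | r * n%:R + c%:R <= (visits B n f)%:R]).
    apply: sequence_events_bigcap => c; apply: sequence_events_bigcup => n.
    exact: (sequence_events_visits n [set k | r * n%:R + c%:R <= k%:R]).
  apply/seteqP; split=> f /= Uf c; first by have [n] := Uf c; exists n.
  by have [//|n _ nf] := Uf c; exists n.
have shiftU : shift @^-1` U = U.
  apply/seteqP; split=> f /= Uf c; have [n] := Uf c.+1.
    move=> nf; exists n.+1; rewrite visitsS natrD -natr1.
    by move: nf; rewrite -natr1; have := ler0n R (f \in B); lra.
  case: n => [|n]; rewrite -natr1.
    by rewrite /visits big_ord0 mulr0 add0r leNgt ltr_wpDl.
  move=> nf; exists n; move: nf; rewrite visitsS natrD -natr1.
  have : (f \in B)%:R <= 1 :> R by rewrite lern1 leq_b1.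
  by rewrite mulrDr mulr1; lra.
have := X_ergodic mU shiftU; case=> PU; last first.
  (* With c = 1 the witness n cannot be 0, as 0 visits are less than 1. *)
  suff : r <= fine (P [set w | B (path_of X w)]) by rewrite leNgt Pr.
  apply: maximal_visits => //; apply: (@subset_measure0 _ _ _ _ _
    (~` [set w | U (path_of X w)])).
  - rewrite (_ : [set w | _] = [set w | (\bigcap_n [set f : int -> A |
      (0 < n)%N -> (visits B n f)%:R < r * n%:R]) (path_of X w)]).
      apply: mp; apply: sequence_events_bigcap => n.
      exact: (sequence_events_visits n
        [set k | (0 < n)%N -> k%:R < r * n%:R]).
    by apply/seteqP; split=> w Dw n => [_|]; exact: Dw.
  - by apply: measurableC; exact: mp.
  - move=> w /= Dw Uw; have [[|n]] := Uw 1%N.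
      by rewrite /visits big_ord0 mulr0 add0r ler10.
    by rewrite leNgt (lt_le_trans (Dw n.+1 _))// lerDl.
  - by apply: etrans (probability_setC P (mp mU)) _; rewrite PU subee.
exists [set w | U (path_of X w)]; split=> //; first exact: mp.
move=> w /= nw; apply: contrapT => nU; apply: nw.
have [c nc] : exists c, forall n, (visits B n (path_of X w))%:R < r * n%:R + c%:R.
  apply: contrapT => h; apply: nU => c; apply: contrapT => h'; apply: h.
  exists c => n; rewrite ltNge; apply/negP => h''; apply: h'.
  by exists n.
exists (Num.truncn (c%:R / (s - r))).+1 => // n /= nN.
rewrite (le_trans (ltW (nc n)))// -lerBrDl -mulrBl mulrC -ler_pdivrMr ?subr_gt0//.
by rewrite ltW// (lt_le_trans (truncnS_gt _))// ler_nat.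
Qed.

(** The upper bound, applied to the complement of B. *)
Lemma visits_ge_eventually B (r : R) : sequence_events B -> 0 <= r ->
  r < fine (P [set w | B (path_of X w)]) ->
  \forall w \ae P, \forall n \near \oo,
    r * n%:R <= (visits B n (path_of X w))%:R.
Proof.
move=> mB r0 rP; set p := fine _ in rP; pose q := (r + p) / 2.
have PC : fine (P [set w | (~` B) (path_of X w)]) = 1 - p.
  rewrite (_ : [set w | _] = ~` [set w | B (path_of X w)])//.
  rewrite probability_setC; last exact: mp.
  by rewrite fineB ?fin_path.
have := @visits_lt_eventually (~` B) (1 - q) (1 - r).
rewrite PC => /(_ (sequence_eventsC mB)).
move=> /(_ ltac:(rewrite /q; lra)) /(_ ltac:(rewrite /q; lra)).
move=> /(_ ltac:(rewrite /q; lra)).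
apply: filterS => w; apply: filterS => n.
have : n%:R = (visits B n (path_of X w))%:R +
  (visits (~` B) n (path_of X w))%:R :> R by rewrite -natrD visitsC.
by lra.
Qed.

End Frequencies.

(** * Words, and events that look at finitely many letters *)

Section Words.
Context {A : countType}.
Implicit Types (f g : int -> A) (i j : int) (l m : nat) (s : seq int).

(** The m successive times from j on: unlike zrange it is given by its length,
    so that it splits and peels by recursion on m. *)
Definition seg j m : seq int := [seq j + k%:Z | k <- iota 0 m].

Definition word f i l : seq A := [seq f k | k <- seg (i - l%:Z + 1) l].

Lemma segS j m : seg j m.+1 = j :: seg (j + 1) m.
Proof.
rewrite /seg /= addr0 -[in iota 1 m](addn0 1%N) iotaDl -map_comp.
by congr cons; apply: eq_map => k /=; rewrite PoszD addrA.
Qed.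

Lemma seg_add j (m n : nat) : seg j (m + n) = seg j m ++ seg (j + m%:Z) n.
Proof.
elim: m j => [|m IHm] j; first by rewrite addr0.
by rewrite addSn !segS IHm /= -addrA -[1 + _]/(1%:Z + m%:Z) -PoszD.
Qed.

Lemma mem_seg i j m : (i \in seg j m) = (j <= i < j + m%:Z).
Proof.
elim: m j => [|m IHm] j; first by rewrite addr0 in_nil; lia.
by rewrite segS inE IHm; lia.
Qed.

Lemma zrange_seg j m : zrange j (j + m%:Z - 1) = seg j m.
Proof.
rewrite /zrange; case: m => [|m]; first by rewrite ifN //; lia.
rewrite ifT; last by lia.
by rewrite (_ : (absz (j + m.+1%:Z - 1 - j)%R).+1 = m.+1); last lia.
Qed.

Lemma zrange_ends i l : zrange (i - l%:Z + 1) i = seg (i - l%:Z + 1) l.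
Proof. by rewrite -zrange_seg; congr zrange; lia. Qed.

Lemma size_word f i l : size (word f i l) = l.
Proof. by rewrite !size_map size_iota. Qed.

Lemma wordD f i l m : word f i (l + m) = word f (i - m%:Z) l ++ word f i m.
Proof.
rewrite /word (_ : i - (l + m)%:Z + 1 = i - m%:Z - l%:Z + 1); last by lia.
rewrite seg_add map_cat; congr (_ ++ [seq f k | k <- seg _ _]); lia.
Qed.

Lemma word_rcons f i l : word f (i + 1) l.+1 = rcons (word f i l) (f (i + 1)).
Proof. by by rewrite -addn1 wordD addrK cats1 {2}/word /= addr0 subrK.
Qed.

Lemma wordE {T : Type} (X : int -> T -> A) i l w :
  str X (i - l%:Z + 1) i w = word (path_of X w) i l.
Proof. by rewrite /str zrange_ends. Qed.

(** Dependence on finitely many coordinates; it makes every set of values of h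
    an event, without any structure on the codomain. *)
Definition finitary {C : Type} (h : (int -> A) -> C) : Prop :=
  exists s, forall f g, {in s, f =1 g} -> h f = h g.

Lemma finitary_event {C : Type} (h : (int -> A) -> C) (Q : set C) :
  finitary h -> sequence_events [set f | Q (h f)].
Proof.
move=> [s hs]; apply: (@sequence_events_coordinates _ s) => f g fg /=.
by rewrite (hs f g fg).
Qed.

Lemma finitary_cst {C : Type} (c : C) : finitary (fun=> c).
Proof. by exists [::]. Qed.

Lemma finitary_coord i : finitary (fun f => f i).
Proof. by exists [:: i] => f g; apply; rewrite inE. Qed.

Lemma finitary_word i l : finitary (fun f => word f i l).
Proof. by exists (seg (i - l%:Z + 1) l) => f g /eq_in_map. Qed.

Lemma finitary2 {C D E : Type} (F : C -> D -> E) (h : (int -> A) -> C) k :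
  finitary h -> finitary k -> finitary (fun f => F (h f) (k f)).
Proof.
move=> [s hs] [t kt]; exists (s ++ t) => f g fg.
by rewrite (hs f g) ?(kt f g)// => i si; apply: fg; rewrite mem_cat si ?orbT.
Qed.

Lemma finitary_sum {V : nmodType} (h : int -> (int -> A) -> V) s :
  (forall i, finitary (h i)) -> finitary (fun f => \sum_(i <- s) h i f).
Proof.
move=> fh; elim: s => [|i s IHs].
  by exists [::] => f g _; rewrite !big_nil.
have := finitary2 +%R (fh i) IHs.
by move=> [t ht]; exists t => f g /ht; rewrite !big_cons.
Qed.

End Words.

(** * The law of a process *)

Section Law.
Context {d : measure_display} {T : measurableType d} {R : realType}.
Variable P : probability T R.
Context {A : countType}.
Variable X : int -> T -> A.
Hypothesis X_process : process X.
Implicit Types (S : set (int -> A)).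

Definition law S : R := fine (P [set w | S (path_of X w)]).

Let mp := measurable_path X_process.

Lemma lawE S : sequence_events S ->
  (law S)%:E = P [set w | S (path_of X w)].
Proof. by move=> mS; rewrite fineK//; apply: fin_num_measure; exact: mp. Qed.

Lemma law_ge0 S : 0 <= law S.
Proof. exact: fine_ge0. Qed.

Lemma law_setT : law setT = 1.
Proof.
rewrite /law (_ : [set w | _] = setT); last by apply/seteqP.
by rewrite (_ : P setT = 1%E) //; exact: probability_setT.
Qed.

Lemma le_law S S' : sequence_events S -> sequence_events S' ->
  S `<=` S' -> law S <= law S'.
Proof.
move=> mS mS' SS'; rewrite -lee_fin !lawE//; apply: le_measure.
- by rewrite inE; exact: mp.
- by rewrite inE; exact: mp.
- by move=> w /SS'.
Qed.

Lemma law_set0 S : S `<=` set0 -> law S = 0.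
Proof.
move=> S0; rewrite /law (_ : [set w | _] = set0) ?measure0//.
by apply/seteqP; split=> w // /S0.
Qed.

Lemma lawU_le S1 S2 : sequence_events S1 -> sequence_events S2 ->
  law (S1 `|` S2) <= law S1 + law S2.
Proof.
move=> m1 m2; rewrite -lee_fin EFinD !lawE//; last exact: sequence_eventsU.
exact: (@measureU2 _ _ _ P [set w | S1 (path_of X w)]
  [set w | S2 (path_of X w)] (mp m1) (mp m2)).
Qed.

Lemma lawU S1 S2 : sequence_events S1 -> sequence_events S2 ->
  S1 `&` S2 `<=` set0 -> law (S1 `|` S2) = law S1 + law S2.
Proof.
move=> m1 m2 S12; apply/EFin_inj; rewrite EFinD !lawE//;
  last exact: sequence_eventsU.
apply: (@measureU _ _ _ P [set w | S1 (path_of X w)]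
  [set w | S2 (path_of X w)] (mp m1) (mp m2)).
by apply/seteqP; split=> w // /S12.
Qed.

Lemma law_le_sum (I : eqType) (r : seq I) (F : I -> set (int -> A)) S :
  sequence_events S -> (forall i, sequence_events (F i)) ->
  (forall f, S f -> exists2 i, i \in r & F i f) ->
  law S <= \sum_(i <- r) law (F i).
Proof.
move=> mS mF; elim: r S mS => [|i r IHr] S mS SF.
  by rewrite big_nil law_set0// => f /SF [i].
rewrite big_cons.
have mD : sequence_events (S `&` ~` F i).
  by apply: sequence_eventsI => //; exact: sequence_eventsC.
apply: le_trans (_ : _ <= law (F i) + law (S `&` ~` F i)) _.
  apply: le_trans (lawU_le (mF i) mD).
  apply: le_law => //; first exact: sequence_eventsU.
  by move=> f Sf; have [?|?] := pselect (F i f); [left|right].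
rewrite lerD2l; apply: IHr => // f [/SF [k + Fk] nFi].
by rewrite inE => /predU1P[ki|kr]; [case: nFi; rewrite -ki|exists k].
Qed.

(** Countable additivity: an inequality between two events may be checked
    conditionally on a variable that takes countably many values. *)
Lemma law_le_fiberwise (C : countType) (h : (int -> A) -> C) S S' (a : R) :
  sequence_events S -> sequence_events S' ->
  (forall Q : set C, sequence_events [set f | Q (h f)]) -> 0 <= a ->
  (forall c, law (S `&` [set f | h f = c]) <=
             a * law (S' `&` [set f | h f = c])) ->
  law S <= a * law S'.
Proof.
move=> mS mS' mh a0 hc.
pose F (S0 : set (int -> A)) n := S0 `&` [set f | pickle (h f) = n].
have mF S0 n : sequence_events S0 -> sequence_events (F S0 n).
  by move=> mS0; apply: sequence_eventsI => //; exact: (mh [set c | pickle c = n]).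
have lawF S0 : sequence_events S0 ->
    (law S0)%:E = (\sum_(n <oo) (law (F S0 n))%:E)%E.
  move=> mS0; rewrite lawE//.
  rewrite (_ : [set w | _] = \bigcup_n [set w | F S0 n (path_of X w)]).
    rewrite measure_bigcup//=.
    - under eq_eseriesl do rewrite in_setT.
      by apply: eq_eseriesr => n _; rewrite lawE//; exact: mF.
    - by move=> n _; apply: mp; exact: mF.
    - apply/trivIsetP => i j _ _ ij; rewrite -subset0 => w.
      by move=> [[_ /= hi] [_ /= hj]]; move: ij; rewrite -hi -hj eqxx.
  apply/seteqP; split=> w /= => [Sw|[n _ []//]].
  by exists (pickle (h (path_of X w))).
rewrite -lee_fin EFinM !lawF// -nneseriesZl//; last first.
  by move=> n _; rewrite lee_fin law_ge0.
apply: lee_nneseries => [n _|n _]; rewrite -?EFinM lee_fin ?law_ge0//.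
have [[c cn]|nc] := pselect (exists c : C, pickle c = n).
  suff FE S0 : F S0 n = S0 `&` [set f | h f = c] by rewrite !FE.
  rewrite /F -cn; congr (_ `&` _); apply/seteqP; split=> f /= => [|->//].
  exact: pcan_inj pickleK _ _.
rewrite law_set0 ?mulr_ge0 ?law_ge0// => f [_ /= hf]; apply: nc.
by exists (h f).
Qed.

Hypothesis X_stationary : stationary P X.

(** Two-sided stationarity: windows may be moved to the left as well. *)
Lemma law_shift (Q : set (seq A)) (j k : int) m :
  law [set f | Q [seq f i | i <- seg j m]] =
  law [set f | Q [seq f i | i <- seg k m]].
Proof.
pose g (j : int) := law [set f : int -> A | Q [seq f i | i <- seg j m]].
have gS i : g (i + 1) = g i.
  have mQ : sequence_events [set f : int -> A | Q [seq f k | k <- seg i m]].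
    apply: (finitary_event Q); exists (seg i m) => f f' /eq_in_map.
    exact.
  rewrite /g /law -(X_stationary mQ); congr (fine (P _)).
  rewrite (_ : seg (i + 1) m = [seq k + 1 | k <- seg i m]).
    by apply/seteqP; split=> w /=; rewrite -map_comp.
  by rewrite /seg -map_comp; apply: eq_map => n /=; lia.
suff g0 i : g i = g 0 by rewrite -/(g j) -/(g k) !g0.
elim: i => [//|n IHn|n IHn]; first by rewrite -IHn -[RHS]gS; congr g; lia.
by rewrite -IHn -[LHS]gS; congr g; lia.
Qed.

End Law.

(** * Real inequalities *)

Section RealInequalities.
Context {R : realType}.

(** Invert exp (- y) >= 1 - y, the only input: 1 + y + 2 y^2 is at least
    1 / (1 - y) as long as y <= 1 / 2. *)
Lemma expR_le_quadratic (y : R) : `|y| <= 1 / 2 ->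
  expR y <= 1 + y + 2 * y ^+ 2.
Proof.
rewrite ler_norml => /andP[y1 y2].
have h : 1 - y <= expR (- y) by exact: expR_ge1Dx.
have yq : 0 <= y ^+ 2 by exact: sqr_ge0.
rewrite -[expR y]mul1r -ler_pdivlMr ?expR_gt0// -expRN.
apply: le_trans (_ : _ <= (1 + y + 2 * y ^+ 2) * (1 - y)) _; first by nra.
by apply: ler_wpM2l h; nra.
Qed.

(** A step of a walk that is centred up to a downward drift 2 c^2 has
    exponential moment at most 1: the second-order term of the moment is at
    most 2 c^2 p (1 - p). *)
Lemma mean_exp_step_le1 (p c : R) : 0 <= p -> p <= 1 -> `|c| <= 1 / 2 ->
  p * expR (c * (1 - p) - 2 * c ^+ 2) +
  (1 - p) * expR (c * (0 - p) - 2 * c ^+ 2) <= 1.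
Proof.
move=> p0 p1 cb; have cq : 0 <= c ^+ 2 by exact: sqr_ge0.
have bound q : 0 <= q -> q <= 1 -> `|c * q| <= 1 / 2.
  by move=> q0 q1; rewrite normrM (ger0_norm q0); have := normr_ge0 c; nra.
rewrite !expRD (mulrA p) (mulrA (1 - p)) -mulrDl expRN.
rewrite ler_pdivrMr ?expR_gt0// mul1r.
apply: le_trans (expR_ge1Dx _).
have h1 := expR_le_quadratic (bound (1 - p) ltac:(lra) ltac:(lra)).
have h2 : expR (c * (0 - p)) <= 1 - c * p + 2 * (c * p) ^+ 2.
  have := @expR_le_quadratic (c * (0 - p)).
  by rewrite sub0r mulrN normrN sqrrN; apply; exact: bound.
apply: le_trans (lerD (ler_wpM2l p0 h1) (ler_wpM2l (_ : 0 <= 1 - p) h2)) _.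
  lra.
have pq : 0 <= p * (1 - p) by apply: mulr_ge0 => //; lra.
rewrite (_ : p * _ + _ = 1 + 2 * c ^+ 2 * (p * (1 - p))); last by ring.
by rewrite lerD2l ler_piMr//; nra.
Qed.

(** For k a >= 3 the inequality exp y >= y^k / k! makes exp (- b n^a) at most a
    multiple of n^-3. The bound is stated as a difference so that it sums by
    telescoping. *)
Lemma stretched_expR_le (a b : R) : 0 < a -> 0 < b ->
  exists2 C : R, 0 <= C & forall n : nat,
    n.+2%:R * expR (- (b * n.+1%:R `^ a)) <= C * (n.+1%:R^-1 - n.+2%:R^-1).
Proof.
move=> a0 b0; pose k := (Num.truncn (3 / a)).
have ka : 3 <= a * k.+1%:R.
  by rewrite mulrC -ler_pdivrMr// ltW// truncnS_gt.
pose D : R := k.+1`!%:R / b ^+ k.+1.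
have D0 : 0 <= D by rewrite divr_ge0// exprn_ge0// ltW.
exists (4 * D) => [|n]; first by rewrite mulr_ge0.
set N : R := n.+1%:R; have N1 : 1 <= N by rewrite ler1n.
have N0 : 0 < N by exact: lt_le_trans N1.
have -> : n.+2%:R = N + 1 :> R by rewrite /N natr1.
have eN : expR (- (b * N `^ a)) <= D / N ^+ 3.
  have y0 : 0 < b * N `^ a by rewrite mulr_gt0// powR_gt0.
  rewrite expRN -[leRHS]invrK lef_pV2 ?posrE ?expR_gt0//; last first.
    by rewrite invr_gt0 !divr_gt0 ?exprn_gt0// ltr0n fact_gt0.
  apply: le_trans (le_trans _ (expR_ge1Dxn k (ltW y0))).
    exact: lexx.
  rewrite -[leLHS]add0r lerD// invf_div /D invf_div mulrA.
  rewrite ler_pM2r ?invr_gt0 ?ltr0n ?fact_gt0// exprMn mulrC.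
  rewrite ler_pM2l ?exprn_gt0// -(@powR_mulrn _ (N `^ a)) ?powR_ge0//.
  by rewrite -powRrM -(powR_mulrn 3 (ltW N0)) ler_powR.
apply: le_trans (ler_wpM2l (_ : 0 <= N + 1) eN) _; first by rewrite addr_ge0 ?ltW.
have -> : N^-1 - (N + 1)^-1 = N^-1 * (N + 1)^-1.
  by field; apply/andP; split; rewrite gt_eqF// addr_gt0.
rewrite (_ : (N + 1) * (D / N ^+ 3) =
  D * (N ^-1 * (N + 1)^-1) * ((N + 1) ^+ 2 / N ^+ 2)); last first.
  by field; apply/andP; split; rewrite gt_eqF// addr_gt0.
rewrite [leRHS](_ : _ = D * (N^-1 * (N + 1)^-1) * 4); last by ring.
rewrite ler_wpM2l//.
  by rewrite mulr_ge0// mulr_ge0// invr_ge0 ?addr_ge0// ltW.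
by rewrite ler_pdivrMr ?exprn_gt0//; nra.
Qed.

(** The inequality n^(1 - g) <= r n means n^g >= 1 / r, whence N. *)
Lemma powR_sublinear (g r : R) : 0 < g -> 0 < r ->
  \forall n \near \oo, n%:R `^ (1 - g) <= r * n%:R.
Proof.
move=> g0 r0; pose N := r^-1 `^ g^-1.
have r'0 : 0 < r^-1 by rewrite invr_gt0.
exists (Num.truncn N).+1 => // n /= nN.
have nNR : N <= n%:R.
  by rewrite ltW// (lt_le_trans (truncnS_gt _))// ler_nat.
have n0 : 0 < n%:R :> R by rewrite ltr0n (leq_trans _ nN).
rewrite powRD; last by rewrite (gt_eqF n0) implybT.
rewrite (powRr1 (ltW n0)) powRN [leLHS]mulrC ler_pM2r// -[leRHS]invrK.
rewrite lef_pV2 ?posrE ?powR_gt0//.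
have -> : r^-1 = N `^ g by rewrite /N -powRrM mulVf ?(gt_eqF g0)// powRr1 ?ltW.
by apply: ge0_ler_powR => //; rewrite ?nnegrE ?powR_ge0// ltW.
Qed.

End RealInequalities.

(** * Deviations of the empirical transition probabilities *)

Section NextLetter.
Context {d : measure_display} {T : measurableType d} {R : realType}.
Variable P : probability T R.
Context {A : countType}.
Variables (X : int -> T -> A) (K : nat).

(** P (X_1 = x | X_(1-K)^0 = z), and 0 when z has probability 0. *)
Definition transition (z : seq A) (x : A) : R :=
  law P X [set f | word f 1 K.+1 = rcons z x] /
  law P X [set f | word f 0 K = z].

Hypothesis X_process : process X.
Hypothesis X_stationary : stationary P X.
Hypothesis X_markov : markov_property P X K.

Lemma event_word (j : int) l (Q : set (seq A)) :
  sequence_events [set f : int -> A | Q (word f j l)].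
Proof. exact: (finitary_event _ (finitary_word j l)). Qed.

Lemma le_law_rcons (j : int) l s (x : A) :
  law P X [set f | word f (j + 1) l.+1 = rcons s x] <=
  law P X [set f | word f j l = s].
Proof.
apply: le_law => //; [exact: (event_word _ _ [set v | v = rcons s x])|
  exact: (event_word _ _ [set v | v = s])|].
by move=> f /=; rewrite word_rcons => /rcons_inj[].
Qed.

Lemma transition_ge0 z x : 0 <= transition z x.
Proof. by rewrite divr_ge0// law_ge0. Qed.

Lemma transition_le1 z x : transition z x <= 1.
Proof.
have := le_law_rcons 0 K z x; rewrite add0r /transition.
have [->|z0] := eqVneq (law P X [set f | word f 0 K = z]) 0.
  by rewrite invr0 mulr0.
by rewrite ler_pdivrMr ?mul1r// lt_def z0 law_ge0.
Qed.

Lemma cprob_word (j : int) l s x :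
  cprob P [set w | X (j + 1) w = x] [set w | str X (j - l%:Z + 1) j w = s] =
  law P X [set f | word f (j + 1) l.+1 = rcons s x] /
  law P X [set f | word f j l = s].
Proof.
rewrite /cprob /law; congr (fine (P _) / fine (P _)).
  apply/seteqP; split=> w /=; rewrite wordE word_rcons; first by case=> <- <-.
  by move=> /rcons_inj[<- <-].
by apply/seteqP; split=> w /=; rewrite wordE.
Qed.

Lemma transition_eq (j : int) z x :
  transition z x = law P X [set f | word f (j + 1) K.+1 = rcons z x] /
    law P X [set f | word f j K = z].
Proof.
congr (_ / _).
  exact: (law_shift X_stationary [set v | v = rcons z x]
    (1 - K.+1%:Z + 1) (j + 1 - K.+1%:Z + 1) K.+1).
exact: (law_shift X_stationary [set v | v = z]
  (0 - K%:Z + 1) (j - K%:Z + 1) K).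
Qed.

(** The Markov property without division, so that it also covers words of
    probability 0. *)
Lemma law_word_rcons (j : int) l s x : (K <= l)%N -> size s = l ->
  law P X [set f | word f (j + 1) l.+1 = rcons s x] =
  transition (drop (l - K) s) x * law P X [set f | word f j l = s].
Proof.
move=> Kl sl; have := le_law_rcons j l s x.
have [->|s0] := eqVneq (law P X [set f | word f j l = s]) 0.
  move=> s0; rewrite mulr0; apply/eqP; rewrite eq_le s0 /=; exact: law_ge0.
move=> _; apply: (canRL (divfK s0)).
rewrite (transition_eq j) -!cprob_word//.
have sz : size (drop (l - K) s) = K by rewrite size_drop; lia.
have /= := @X_markov j (take (l - K) s) _ x sz.
rewrite cat_take_drop sl; apply.
have -> : P [set w | str X (j - l%:Z + 1) j w = s] =
    (law P X [set f | word f j l = s])%:E.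
  rewrite lawE//; last exact: (event_word _ _ [set v | v = s]).
  by congr (P _); apply/seteqP; split=> w /=; rewrite wordE.
by rewrite lte_fin lt_def s0 law_ge0.
Qed.

End NextLetter.

Section Concentration.
Context {d : measure_display} {T : measurableType d} {R : realType}.
Variable P : probability T R.
Context {A : countType}.
Variables (X : int -> T -> A) (K : nat).
Hypothesis X_process : process X.
Hypothesis X_stationary : stationary P X.
Hypothesis X_markov : markov_property P X K.
Implicit Types (z : seq A) (x : A).

(** The logarithmic increments of an exponential supermartingale: centred
    successes scaled by c, with the drift that mean_exp_step_le1 asks for,
    which is paid only at the occurrences of z. *)
Definition increment z x (c : R) (i : int) (f : int -> A) : R :=
  if word f i K == z then
    c * ((f (i + 1) == x)%:R - transition P X K z x) - 2 * c ^+ 2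
  else 0.

Lemma finitary_increment z x c i : finitary (increment z x c i).
Proof.
apply: (finitary2 (fun u v => if u == z then
  c * ((v == x)%:R - transition P X K z x) - 2 * c ^+ 2 else 0)).
  exact: finitary_word.
exact: finitary_coord.
Qed.

Let event_walk (j j' : int) l m z x c (Q : set (seq A)) (t : R) :
  sequence_events [set f | Q (word f j l) /\
    t <= \sum_(i <- seg j' m) increment z x c i f].
Proof.
apply: (finitary_event (fun u => Q u.1 /\ t <= u.2)
  (h := fun f => (word f j l, \sum_(i <- seg j' m) increment z x c i f))).
apply: (finitary2 pair); first exact: finitary_word.
by apply: finitary_sum => i; exact: finitary_increment.
Qed.

Let ev := @event_word A.

(** Chernoff's bound for the supermartingale exp (sum of increments), obtained
    for probabilities directly, without its expectation. Induction on the
    number m of steps: once the word s that ends at j is fixed, the first step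
    is 0 if s does not end with z; otherwise it takes one of two values
    according to the next letter, and the bounds for the remaining steps,
    with t diminished by that value, add up by mean_exp_step_le1. Conditioning
    on words of any length l >= K makes the induction go through, since the
    past grows by one letter at each step. *)
Lemma walk_tail z x (c t : R) (j : int) l m (Q : set (seq A)) :
  `|c| <= 1 / 2 -> (K <= l)%N ->
  law P X [set f | Q (word f j l) /\
    t <= \sum_(i <- seg j m) increment z x c i f] <=
  expR (- t) * law P X [set f | Q (word f j l)].
Proof.
move=> cb; elim: m => [|m IHm] in j l t Q *; move=> Kl.
  have [t0|t0] := leP t 0.
    apply: le_trans (_ : _ <= law P X [set f | Q (word f j l)]) _.
      by apply: le_law => // f [].
    by rewrite ler_peMl ?law_ge0// -expR0 ler_expR oppr_ge0.
  rewrite law_set0 ?mulr_ge0 ?expR_ge0 ?law_ge0// => f /= [_].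
  by rewrite big_nil leNgt t0.
apply: (law_le_fiberwise X_process (h := fun f => word f j l)) => //.
move=> s; have [[sl Qs]|nS] := pselect (size s = l /\ Q s); last first.
  rewrite law_set0 ?mulr_ge0 ?expR_ge0 ?law_ge0// => f /= [[Qf _] fs].
  by apply: nS; rewrite -fs size_word.
rewrite (_ : [set f | Q _] `&` _ = [set f | word f j l = s]); last first.
  by apply/seteqP; split=> f /= => [[]//|fs]; split=> //; rewrite fs.
have drop_s f : word f j l = s -> word f j K = drop (l - K) s.
  move=> <-; rewrite -{2}(subnK Kl) wordD drop_size_cat//.
  by rewrite size_word.
(* A word s not ending with z: nothing happens at j, and s is recovered from
   the longer word that ends at j + 1. *)
have [sz|sz] := eqVneq (drop (l - K) s) z; last first.
  pose Q1 := [set v : seq A | take l v = s].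
  have E1 : [set f : int -> A | word f j l = s] =
      [set f | Q1 (word f (j + 1) l.+1)].
    apply/seteqP; split=> f /=; rewrite /Q1 /= word_rcons -cats1
      take_size_cat ?size_word//.
  rewrite E1; apply: le_trans (IHm (j + 1) l.+1 t Q1 (leqW Kl)).
  apply: le_law => //.
    by apply: sequence_eventsI => //; exact: ev.
  move=> f /= [[_ tf] fs].
  split; first by move: fs; rewrite /Q1.
  have /drop_s fz : word f j l = s by move: fs; rewrite -[Q1 _]/([set f |
    Q1 (word f (j + 1) l.+1)] f) -E1.
  by move: tf; rewrite segS big_cons {1}/increment fz (negPf sz) add0r.
(* A word s ending with z: split by the next letter. *)
pose p := transition P X K z x.
pose al := c * (1 - p) - 2 * c ^+ 2; pose be := c * (0 - p) - 2 * c ^+ 2.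
pose Q1 := [set v | v = rcons s x].
pose Q2 := [set v | take l v = s /\ v <> rcons s x].
pose S1 := [set f | Q1 (word f (j + 1) l.+1) /\
  t - al <= \sum_(i <- seg (j + 1) m) increment z x c i f].
pose S2 := [set f | Q2 (word f (j + 1) l.+1) /\
  t - be <= \sum_(i <- seg (j + 1) m) increment z x c i f].
set pi := law P X [set f | word f j l = s].
have law1 : law P X [set f | Q1 (word f (j + 1) l.+1)] = p * pi.
  by rewrite /Q1 /= (law_word_rcons X_process X_stationary X_markov _ _ Kl)// sz.
have law2 : law P X [set f | Q2 (word f (j + 1) l.+1)] = (1 - p) * pi.
  apply: (@addrI _ (p * pi)); rewrite -mulrDl subrKC mul1r -{1}law1.
  rewrite -lawU//; last by move=> f [/= -> []].
  congr (law _ _ _); apply/seteqP; split=> f /=; rewrite /Q1 /Q2 /=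
    word_rcons -cats1 take_size_cat ?size_word//.
    by case=> [|[]//]; rewrite cats1 => /rcons_inj[].
  by move=> fs; have [?|?] := pselect (word f j l ++ [:: f (j + 1)] =
    rcons s x); [left|right].
apply: le_trans (_ : _ <= law P X S1 + law P X S2) _.
  have mS1 : sequence_events S1 by exact: event_walk.
  have mS2 : sequence_events S2 by exact: event_walk.
  apply: le_trans (lawU_le P X_process mS1 mS2).
  apply: le_law => //.
  - apply: sequence_eventsI; [exact: event_walk|exact: (ev _ _ [set v | v = s])].
  - exact: sequence_eventsU.
  move=> f /= [[_ tf] fs].
  move: tf; rewrite segS big_cons {1}/increment (drop_s _ fs) sz eqxx.
  have [fx|fx] := eqVneq (f (j + 1)) x; rewrite -/p -lerBlDl => tf.
    by left; split=> //; rewrite /Q1 /= word_rcons fs fx.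
  right; split=> //; rewrite /Q2 /= word_rcons fs -cats1 take_size_cat//.
  by split=> //; rewrite cats1 => /rcons_inj[/eqP]; rewrite (negPf fx).
apply: le_trans (lerD (IHm _ _ _ _ (leqW Kl)) (IHm _ _ _ _ (leqW Kl))) _.
have eD u : expR (- (t - u)) = expR (- t) * expR u.
  by rewrite -expRD opprB addrC.
rewrite law1 law2 !eD.
rewrite (_ : _ + _ = expR (- t) * (p * expR al + (1 - p) * expR be) * pi);
  last by ring.
rewrite -mulrA ler_wpM2l ?expR_ge0// ler_piMl ?law_ge0//.
by apply: mean_exp_step_le1 => //; [exact: transition_ge0|exact: transition_le1].
Qed.

End Concentration.

Section Deviation.
Context {A : countType} {R : realType}.
Variables (K : nat) (x : A).
Implicit Types (s : seq int) (z : seq A) (f : int -> A).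

Definition hits s z f : nat := count (fun i => word f i K == z) s.

Definition successes s z f : nat :=
  count (fun i => (word f i K == z) && (f (i + 1) == x)) s.

Definition deviates (p : seq A -> R) (e : R) s z f : Prop :=
  e * (hits s z f)%:R < `|(successes s z f)%:R - p z * (hits s z f)%:R|.

(** No count changes when the times before the first occurrence of z are
    dropped, and from there on z is the word just read, which belongs to the
    past. There is an occurrence because the inequality in deviates is
    strict. *)
Lemma deviates_first_hit p e j (m : nat) z f : deviates p e (seg j m) z f ->
  exists2 k, (k < m)%N & [/\ word f (j + k%:Z) K = z,
    hits (seg j m) z f = hits (seg (j + k%:Z) (m - k)) z f &
    deviates p e (seg (j + k%:Z) (m - k)) z f].
Proof.
move=> dev; have [hz|/hasPn nhz] := boolP
    (has (fun k => word f (j + k%:Z) K == z) (iota 0 m)); last first.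
  have h0 : hits (seg j m) z f = 0%N.
    apply/eqP; rewrite -leqn0 leqNgt -has_count has_map; apply/hasPn => k.
    exact: nhz.
  have s0 : successes (seg j m) z f = 0%N.
    apply/eqP; rewrite -leqn0 -h0; apply: sub_count => i /= /andP[].
    by [].
  by move: dev; rewrite /deviates h0 s0 !mulr0 subr0 normr0 ltxx.
have exk : exists k, (k < m)%N && (word f (j + k%:Z) K == z).
  by have /hasP[k] := hz; rewrite mem_iota => km kz; exists k; rewrite kz andbT.
have [k /andP[km /eqP kz] kmin] := ex_minnP exk.
have before i : i \in seg j k -> (word f i K == z) = false.
  rewrite mem_seg => ik; apply/negbTE/negP => iz.
  have := kmin `|i - j|%N; rewrite (_ : j + `|i - j|%N%:Z = i); last by lia.
  by rewrite iz andbT; lia.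
have sE : seg j m = seg j k ++ seg (j + k%:Z) (m - k).
  by rewrite -seg_add subnKC// ltnW.
have hE : hits (seg j m) z f = hits (seg (j + k%:Z) (m - k)) z f.
  rewrite /hits sE count_cat -[RHS]add0n; congr (_ + _)%N.
  by rewrite (eq_in_count before) count_pred0.
have tE : successes (seg j m) z f = successes (seg (j + k%:Z) (m - k)) z f.
  rewrite /successes sE count_cat -[RHS]add0n; congr (_ + _)%N.
  rewrite (@eq_in_count _ _ pred0) ?count_pred0// => i /before.
  by move=> /= ->.
by exists k => //; split=> //; rewrite /deviates -hE -tE.
Qed.

Lemma finitary_hits s : finitary (fun f z => hits s z f).
Proof.
elim: s => [|i s IHs]; first exact: (finitary_cst (fun _ : seq A => 0%N)).
exact: (finitary2 (fun u h z => ((u == z) + h z)%N) (finitary_word i K) IHs).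
Qed.

Lemma finitary_successes s : finitary (fun f z => successes s z f).
Proof.
elim: s => [|i s IHs]; first exact: (finitary_cst (fun _ : seq A => 0%N)).
exact: (finitary2 (fun u h z => (((u.1 == z) && (u.2 == x)) + h z)%N)
  (finitary2 pair (finitary_word i K) (finitary_coord (i + 1))) IHs).
Qed.

Lemma event_deviates p e (M : R) s j :
  sequence_events [set f : int -> A | M <= (hits s (word f j K) f)%:R /\
    deviates p e s (word f j K) f].
Proof.
exact: (finitary_event (fun u => M <= (u.1.1 u.2)%:R /\
    e * (u.1.1 u.2)%:R < `|(u.1.2 u.2)%:R - p u.2 * (u.1.1 u.2)%:R|)
  (finitary2 pair (finitary2 pair (finitary_hits s) (finitary_successes s))
    (finitary_word j K))).
Qed.

End Deviation.

Section DeviationBounds.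
Context {d : measure_display} {T : measurableType d} {R : realType}.
Variable P : probability T R.
Context {A : countType}.
Variables (X : int -> T -> A) (K : nat).
Hypothesis X_process : process X.
Hypothesis X_stationary : stationary P X.
Hypothesis X_markov : markov_property P X K.
Variable x : A.
Implicit Types (z : seq A).

Let p z := transition P X K z x.

Lemma sum_increment z (c : R) s f :
  \sum_(i <- s) increment P X K z x c i f =
  c * ((successes K x s z f)%:R - p z * (hits K s z f)%:R)
    - 2 * c ^+ 2 * (hits K s z f)%:R.
Proof.
elim: s => [|i s IHs]; first by rewrite big_nil /=; ring.
rewrite big_cons IHs /increment /successes /hits /= !natrD -/(p z).
by case: (word f i K == z); case: (f (i + 1) == x) => /=; ring.
Qed.

Let dev (e M : R) s j := [set f : int -> A | M <= (hits K s (word f j K) f)%:R /\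
    deviates K x p e s (word f j K) f].

(** Let N be the number of hits. For c = e / 4 when there are too many
    successes, and c = - e / 4 when there are too few, the sum of increments is
    at least |c| e N - 2 c^2 N = e^2 N / 8; this |c| is the best one. *)
Lemma law_deviates_word z (e M : R) (j : int) m : 0 < e -> e <= 1 ->
  law P X (dev e M (seg j m) j `&` [set f | word f j K = z]) <=
  2 * expR (- (e ^+ 2 / 8 * M)) * law P X [set f | word f j K = z].
Proof.
move=> e0 e1; pose S c := [set f | word f j K = z /\
  e ^+ 2 / 8 * M <= \sum_(i <- seg j m) increment P X K z x c i f].
have eS c : sequence_events (S c).
  apply: (finitary_event (fun u => u.1 = z /\ e ^+ 2 / 8 * M <= u.2)
    (h := fun f => (word f j K, \sum_(i <- seg j m) increment P X K z x c i f))).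
  apply: (finitary2 pair); first exact: finitary_word.
  by apply: finitary_sum => i; exact: finitary_increment.
have boundS c : `|c| <= 1 / 2 -> law P X (S c) <=
    expR (- (e ^+ 2 / 8 * M)) * law P X [set f | word f j K = z].
  move=> c1; exact: (walk_tail X_process X_stationary X_markov z x
    (e ^+ 2 / 8 * M) j m [set v | v = z] c1 (leqnn K)).
apply: le_trans (_ : _ <= law P X (S (e / 4) `|` S (- (e / 4)))) _.
  apply: le_law => //.
  - apply: sequence_eventsI; first exact: event_deviates.
    exact: (event_word _ _ [set v | v = z]).
  - exact: sequence_eventsU.
  move=> f /= [[+ +] fz]; rewrite /deviates fz.
  set N := hits _ _ _ _; set s := successes _ _ _ _ _ => MN.
  have eMN : e ^+ 2 / 8 * M <= e ^+ 2 / 8 * N%:R.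
    by rewrite ler_wpM2l// divr_ge0// sqr_ge0.
  rewrite ltr_normr => /orP[] dN; [left|right]; split=> //;
    rewrite sum_increment -/N -/s; apply: le_trans eMN _.
    by have := ler_wpM2l (ltW e0) (ltW dN); nra.
  by have := ler_wpM2l (ltW e0) (ltW dN); nra.
apply: le_trans (lawU_le P X_process (eS _) (eS _)) _.
rewrite -mulrA mulr_natl mulr2n; apply: lerD; apply: boundS.
  by rewrite ger0_norm; lra.
by rewrite normrN ger0_norm; lra.
Qed.

Lemma law_deviates (e M : R) (j : int) m : 0 < e -> e <= 1 ->
  law P X (dev e M (seg j m) j) <= 2 * expR (- (e ^+ 2 / 8 * M)).
Proof.
move=> e0 e1.
rewrite -[leRHS]mulr1 -[X in _ <= _ * X](law_setT P X);
  apply: (law_le_fiberwise X_process (h := fun f => word f j K)) => //.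
- exact: event_deviates.
- exact: sequence_eventsT.
- by move=> Q; exact: event_word.
- by move=> z; rewrite setTI; exact: law_deviates_word.
Qed.

(** Union bound over the first occurrence, at one of at most n + 1 times. *)
Lemma law_deviates_last (e M : R) (n : nat) : 0 < e -> e <= 1 ->
  law P X (dev e M (seg (K%:Z - 1) (n.+1 - K)) n%:Z) <=
  n.+1%:R * (2 * expR (- (e ^+ 2 / 8 * M))).
Proof.
move=> e0 e1; set m := (n.+1 - K)%N.
apply: le_trans (_ : _ <= \sum_(k <- iota 0 m)
  law P X (dev e M (seg (K%:Z - 1 + k%:Z) (m - k)) (K%:Z - 1 + k%:Z))) _.
  apply: law_le_sum => //; first exact: event_deviates.
    by move=> k; exact: event_deviates.
  move=> f /= [Mh /deviates_first_hit[k km [kz hE kdev]]].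
  exists k; first by rewrite mem_iota.
  by rewrite /dev /= kz -hE; split.
apply: le_trans (ler_sum _ (fun k _ => law_deviates _ _ _ e0 e1)) _.
rewrite big_const_seq count_predT size_iota iter_addr_0 -[leLHS]mulr_natl.
by rewrite ler_wpM2r ?mulr_ge0 ?expR_ge0// ler_nat leq_subr.
Qed.

Lemma law0_ae (S : set (int -> A)) : sequence_events S -> law P X S = 0 ->
  \forall w \ae P, ~ S (path_of X w).
Proof.
move=> mS S0; exists [set w | S (path_of X w)]; split.
- exact: measurable_path.
- by rewrite -lawE// S0.
- by move=> w /= /contrapT.
Qed.

(** Borel-Cantelli. A word that occurs n^a times in X_0^n has at least n^a - 1
    occurrences with a successor in X_0^n. *)
Lemma deviates_eventually_not (a e : R) : 0 < a -> 0 < e -> e <= 1 ->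
  \forall w \ae P, \forall n \near \oo,
    n%:R `^ a - 1 <= (hits K (seg (K%:Z - 1) (n.+1 - K))
        (word (path_of X w) n%:Z K) (path_of X w))%:R ->
    ~ deviates K x p e (seg (K%:Z - 1) (n.+1 - K))
        (word (path_of X w) n%:Z K) (path_of X w).
Proof.
move=> a0 e0 e1; set b := e ^+ 2 / 8.
have b0 : 0 < b by rewrite divr_gt0// exprn_gt0.
pose B n := dev e (n%:R `^ a - 1) (seg (K%:Z - 1) (n.+1 - K)) n%:Z.
have mB n : sequence_events (B n) by exact: event_deviates.
pose F n := [set w | B n.+1 (path_of X w)].
have mF n : measurable (F n) by exact: measurable_path.
have [C C0 CP] := stretched_expR_le a0 b0.
have FC n : (P (F n) <= (2 * expR b * C * (n.+1%:R^-1 - n.+2%:R^-1))%:E)%E.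
  rewrite -lawE// lee_fin; apply: le_trans (law_deviates_last _ _ e0 e1) _.
  rewrite -/b mulrBr mulr1 opprB addrC expRD.
  have := ler_wpM2l (_ : 0 <= 2 * expR b) (CP n).
  rewrite mulr_ge0 ?expR_ge0// -[_ * C * _]mulrA => /(_ isT).
  by apply: le_trans; rewrite le_eqVlt; apply/orP; left; apply/eqP; ring.
have sF : (\sum_(n <oo) P (F n) < +oo)%E.
  apply: (@le_lt_trans _ _ (2 * expR b * C)%:E); last exact: ltry.
  apply: lime_le; first by apply: is_cvg_nneseries => n _ _; exact: measure_ge0.
  apply: nearW => N; apply: le_trans (lee_sum _ (fun n _ => FC n)) _.
  rewrite sumEFin lee_fin -mulr_sumr ler_piMr//.
    by rewrite !mulr_ge0// expR_ge0.
  apply: le_trans (_ : _ <= 1 - N.+1%:R^-1) _; last by rewrite gerBl.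
  elim: N => [|N IHN]; first by rewrite big_geq// invr1 subrr.
  rewrite big_nat_recr//=; apply: le_trans (lerD IHN (lexx _)) _.
  by rewrite addrA subrK.
have P0 := lim_sup_set_cvg0 mF sF.
exists (lim_sup_set F); split=> //.
  by apply: bigcapT_measurable => n; apply: bigcup_measurable.
move=> w /= nw N _; apply: contrapT => h; apply: nw; exists N.+1 => // n /=.
case: n => [//|n] Nn Mh dh; by apply: h; exists n.
Qed.

End DeviationBounds.

(** * Occurrences in the observed string *)

Section Occurrences.
Context {T : Type} {A : countType}.
Variables (X : int -> T -> A) (K : nat).
Implicit Types (n : nat) (w : T).

Lemma zrange_past n : zrange (K%:Z - 1) (n%:Z - 1) = seg (K%:Z - 1) (n.+1 - K).
Proof.
have [Kn|nK] := leqP K n.+1.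
  by rewrite -zrange_seg; congr zrange; lia.
rewrite (_ : (n.+1 - K)%N = 0%N); last by lia.
by rewrite /zrange ifN //; lia.
Qed.

Lemma matchesE n w (i : int) : matches X K n%:Z w i =
  (word (path_of X w) i K == word (path_of X w) n%:Z K).
Proof. by rewrite /matches !wordE. Qed.

Lemma past_occurrencesE n w : past_occurrences X K n w =
  hits K (seg (K%:Z - 1) (n.+1 - K)) (word (path_of X w) n%:Z K) (path_of X w).
Proof.
by rewrite /past_occurrences zrange_past; apply: eq_count => i; exact: matchesE.
Qed.

Lemma successor_occurrencesE n w x : successor_occurrences X K n w x =
  successes K x (seg (K%:Z - 1) (n.+1 - K)) (word (path_of X w) n%:Z K)
    (path_of X w).
Proof.
rewrite /successor_occurrences zrange_past; apply: eq_count => i.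
by rewrite matchesE.
Qed.

Lemma occurrencesE n w : occurrences X K n w =
  hits K (seg (K%:Z - 1) (n.+2 - K)) (word (path_of X w) n%:Z K) (path_of X w).
Proof.
have zE : zrange (K%:Z - 1) n%:Z = seg (K%:Z - 1) (n.+2 - K).
  by rewrite -(zrange_past n.+1); congr zrange; lia.
by rewrite /occurrences zE; apply: eq_count => i; exact: matchesE.
Qed.

(** The occurrence at n itself makes the difference. *)
Lemma occurrences_past n w : (K <= n.+1)%N ->
  occurrences X K n w = (past_occurrences X K n w).+1.
Proof.
move=> Kn; rewrite occurrencesE past_occurrencesE subSn// -addn1 seg_add.
rewrite /hits count_cat /= addr0 (_ : K%:Z - 1 + (n.+1 - K)%N%:Z = n%:Z);
  last by lia.
by rewrite eqxx addn1.
Qed.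

End Occurrences.

Section VisitsOfWords.
Context {A : countType}.

Lemma visits_word (K : nat) (Q : pred (seq A)) j m f :
  visits [set g | Q (word g j K)] m f =
  count (fun i => Q (word f i K)) (seg j m).
Proof.
have word_shift g i : word (shift g) i K = word g (i + 1) K.
  rewrite /word (_ : i + 1 - K%:Z + 1 = i - K%:Z + 1 + 1); last by lia.
  rewrite /seg -!map_comp; apply: eq_map => k /=; rewrite /Defs.shift.
  by congr g; lia.
have -> : visits [set g | Q (word g j K)] m f =
    (\sum_(i < m) Q (word f (j + i%:Z) K))%N.
  apply: eq_bigr => i _; congr nat_of_bool.
  transitivity (Q (word (iter i shift f) j K)).
    by apply/idP/idP => [/set_mem|] // h; rewrite mem_set.
  congr (Q _); elim: (i : nat) j f => [|k IHk] j' f'; first by rewrite addr0.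
  by rewrite iterSr IHk word_shift; congr (word f' _ K); lia.
rewrite /seg count_map -sum1_count [RHS]big_mkcond /=.
rewrite -[in RHS](subn0 m) -/(index_iota 0 m) big_mkord.
by apply: eq_bigr => i _; case: (Q _).
Qed.

Lemma count_iota_le (a g : pred nat) n0 n :
  (forall i, (n0 <= i)%N -> a i -> g i) ->
  (count a (iota 0 n) <= n0 + count g (iota 0 n))%N.
Proof.
move=> ag; have [nn0|/ltnW n0n] := leqP n n0.
  by apply: leq_trans (leq_addr _ _); rewrite (leq_trans (count_size _ _))
    ?size_iota.
rewrite -{1 2}(subnKC n0n) iotaD !count_cat add0n.
apply: leq_add; first by rewrite (leq_trans (count_size _ _)) ?size_iota.
rewrite -[leqLHS]add0n leq_add// -!size_filter !size_filter.
rewrite -(@eq_in_count _ (predI a g)).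
  by apply: sub_count => i /= /andP[].
move=> i; rewrite mem_iota => /andP[n0i _] /=.
by case ai : (a i) => //=; exact: ag.
Qed.

End VisitsOfWords.

Section GoodTimes.
Context {d : measure_display} {T : measurableType d} {R : realType}.
Variable P : probability T R.
Context {A : countType}.
Variables (X : int -> T -> A) (K : nat) (gamma : R).
Hypothesis X_process : process X.
Hypothesis X_stationary : stationary P X.
Hypothesis X_ergodic : ergodic P X.
Hypothesis gamma_gt0 : 0 < gamma.

(** There are countably many words, so those of probability 0 have probability 0
    altogether. *)
Lemma word_gt0_ae (j : int) l : \forall w \ae P,
  0 < law P X [set f | word f j l = word (path_of X w) j l].
Proof.
pose S := [set g : int -> A | law P X [set f | word f j l = word g j l] = 0].
have mS : sequence_events S.
  exact: (event_word j l [set v | law P X [set f | word f j l = v] = 0]).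
have S0 : law P X S = 0.
  apply/eqP; rewrite eq_le law_ge0 andbT -(mul0r (law P X setT)).
  apply: (law_le_fiberwise X_process (h := fun f => word f j l)) => //.
  - exact: sequence_eventsT.
  - by move=> Q; exact: event_word.
  move=> z; rewrite mul0r; have [[f [Sf fz]]|nS] :=
    pselect (exists f, S f /\ word f j l = z).
    rewrite -[leRHS]Sf fz; apply: le_law => //.
    + by apply: sequence_eventsI => //; exact: (event_word _ _ [set v | v = z]).
    + exact: (event_word _ _ [set v | v = z]).
  by rewrite law_set0// => f [Sf fz]; apply: nS; exists f.
have := law0_ae X_process mS S0; apply: filterS => w /eqP.
by rewrite lt_def law_ge0 andbT.
Qed.

(** Words of probability 2 r > 0 end up with at least r n occurrences; the
    others do not occur. *)
Lemma frequent_word z : \forall w \ae P, \forall n \near \oo,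
  word (path_of X w) n%:Z K = z ->
  n%:R `^ (1 - gamma) <= (occurrences X K n w)%:R :> R.
Proof.
pose r := law P X [set f | word f (K%:Z - 1) K = z] / 2.
have rE n : law P X [set f | word f n K = z] = r * 2.
  rewrite /r divfK ?pnatr_eq0//.
  exact: (law_shift X_stationary [set v | v = z] _ _ K).
have [r0|r0] := leP r 0.
  have : \forall w \ae P, forall n : nat,
      0 < law P X [set f | word f n%:Z K = word (path_of X w) n%:Z K].
    by apply: ae_foralln => n; exact: word_gt0_ae.
  apply: filterS => w pos; apply: nearW => n nz; exfalso.
  by have := pos n; rewrite nz rE; lra.
have mB : sequence_events [set f : int -> A | word f (K%:Z - 1) K == z].
  exact: (event_word _ _ [set v | v == z]).
have : \forall w \ae P, \forall n \near \oo,
    r * n%:R <= (hits K (seg (K%:Z - 1) n) z (path_of X w))%:R.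
  have := @visits_ge_eventually _ _ _ P _ X X_process X_stationary X_ergodic
    _ r mB (ltW r0).
  rewrite -/(law P X _) (_ : [set f | word f _ K == z] =
    [set f | word f (K%:Z - 1) K = z]); last first.
    by apply/seteqP; split=> f /= /eqP.
  rewrite rE => /(_ ltac:(lra)); apply: filterS => w; apply: filterS => n.
  rewrite (_ : [set f | word f _ K = z] =
    [set f | pred1 z (word f (K%:Z - 1) K)]); last first.
    by apply/seteqP; split=> f /= /eqP.
  by rewrite visits_word.
apply: filterS => w [N _ hN].
have r2 : 0 < r / 2 by rewrite divr_gt0.
have [N' _ hN'] := powR_sublinear gamma_gt0 r2.
(* Only the n + 2 - K times from K - 1 on carry a whole word; for n >= 2 K
   they are at least half of the n first times. *)
exists (N + N' + 2 * K)%N => // n /= nN nz.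
apply: le_trans (hN' n _) _ => /=; first by lia.
rewrite occurrencesE nz; apply: le_trans (hN (n.+2 - K)%N _) => /=; last by lia.
rewrite -mulrA (ler_wpM2l (ltW r0))// ler_pdivrMl// -natrM ler_nat; lia.
Qed.

Lemma frequent_words (s : seq (seq A)) : \forall w \ae P, \forall n \near \oo,
  word (path_of X w) n%:Z K \in s ->
  n%:R `^ (1 - gamma) <= (occurrences X K n w)%:R :> R.
Proof.
elim: s => [|z s IHs]; first by apply: aeW => w; apply: nearW.
move: IHs (frequent_word z); apply: filterS2 => w; apply: filterS2 => n.
by move=> h1 h2; rewrite inE => /predU1P[].
Qed.

(** Enumerate the words and use continuity from below. *)
Lemma likely_words (e : R) : 0 < e -> exists s : seq (seq A),
  1 - e < law P X [set f | word f 0 K \in s].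
Proof.
move=> e0; pose D m := [set f : int -> A | (pickle (word f 0 K) < m)%N].
have mD m : sequence_events (D m).
  exact: (event_word 0 K [set v | (pickle v < m)%N]).
have cD : (fun m => law P X (D m)) @ \oo --> (1 : R).
  apply: fine_cvg; rewrite -(probability_setT P).
  rewrite [X in _ --> P X](_ : _ = \bigcup_m [set w | D m (path_of X w)]).
    apply: nondecreasing_cvg_mu.
    - by move=> m; exact: measurable_path.
    - by apply: bigcupT_measurable => m; exact: measurable_path.
    - by move=> m n mn; apply/subsetPset => w /= /leq_trans; apply.
  apply/seteqP; split=> w // _; exists (pickle (word (path_of X w) 0 K)).+1 => //.
  exact: ltnSn.
have [m _ /(_ m (leqnn m)) /= Dm] :=
  cvgr_gt _ cD _ (ltac:(rewrite ltrBlDr ltrDl//) : 1 - e < 1).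
exists (pmap unpickle (iota 0 m)); apply: lt_le_trans Dm _.
apply: le_law => //; first exact: (event_word 0 K [set v | v \in pmap _ _]).
move=> f /= fm; rewrite mem_pmap; apply/mapP.
by exists (pickle (word f 0 K)); rewrite ?mem_iota ?pickleK.
Qed.

End GoodTimes.

(** * Assembling the theorem *)

Section Conclusions.
Context {d : measure_display} {T : measurableType d} {R : realType}.
Variable P : probability T R.
Context {A : countType}.
Variables (X : int -> T -> A) (K : nat) (gamma : R) (ordest : seq A -> nat).
Hypothesis X_process : process X.
Hypothesis X_stationary : stationary P X.
Hypothesis ordest_consistent :
  \forall w \ae P, \forall n \near \oo, ordest_at ordest X n w = K.

(** The conditioning in next_letter_prob is on K + 1 letters, which almost
    surely form a word of positive probability; the Markov property then drops
    the oldest one. *)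
Lemma next_letter_prob_ae (X_markov : markov_property P X K) x :
  \forall w \ae P, forall n : nat,
    next_letter_prob P X K n x w =
    transition P X K (word (path_of X w) n%:Z K) x.
Proof.
apply: ae_foralln => n.
have := word_gt0_ae P X_process n%:Z K.+1; apply: filterS => w pos.
rewrite /next_letter_prob (_ : n%:Z - K%:Z = n%:Z - K.+1%:Z + 1); last by lia.
rewrite wordE cprob_word (law_word_rcons X_process X_stationary X_markov)//;
  last by rewrite size_word.
rewrite mulfK ?gt_eqF//; congr (transition _ _ _ _ _).
by rewrite -[in LHS](add1n K) wordD addnK drop_size_cat// size_word.
Qed.

Lemma q_hat_cvg (X_markov : markov_property P X K) x :
  0 < 1 - gamma -> \forall w \ae P,
  (fun n => `| q_hat ordest X n x w - next_letter_prob P X K n x w |)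
    @ within (good_times ordest X gamma w) \oo --> (0 : R).
Proof.
move=> a0.
have dev : \forall w \ae P, forall k : nat, \forall n \near \oo,
    n%:R `^ (1 - gamma) - 1 <= (hits K (seg (K%:Z - 1) (n.+1 - K))
        (word (path_of X w) n%:Z K) (path_of X w))%:R ->
    ~ deviates K x (fun z => transition P X K z x) k.+1%:R^-1
        (seg (K%:Z - 1) (n.+1 - K))
        (word (path_of X w) n%:Z K) (path_of X w).
  apply: ae_foralln => k; apply: deviates_eventually_not => //.
  by rewrite invf_le1// ler1n.
move: ordest_consistent (next_letter_prob_ae X_markov x) dev.
apply: filterS3 => w [N1 _ ordK] nlp dev.
apply/cvgr0Pnorm_le => e e0.
pose k := Num.truncn e^-1.
have ke : k.+1%:R^-1 <= e.
  rewrite -[leRHS]invrK lef_pV2 ?posrE ?invr_gt0// ltW// /k truncnS_gt//.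
have [N2 _ hN2] := dev k.
exists (N1 + N2 + K + 2)%N => // n /= nN good.
have ordKn : ordest_at ordest X n w = K by apply: ordK => /=; lia.
rewrite normr_id /q_hat ordKn nlp past_occurrencesE successor_occurrencesE.
have := hN2 n; move: good; rewrite /good_times /good_time /= ordKn.
rewrite occurrences_past; last by lia.
rewrite past_occurrencesE /deviates.
set h := hits _ _ _ _; set s := successes _ _ _ _ _.
set t := transition _ _ _ _ _.
rewrite -natr1 -lerBlDr => good /(_ ltac:(rewrite /=; lia) good) /negP.
rewrite -leNgt => dh.
have h0 : 0 < h%:R :> R.
  apply: lt_le_trans good; rewrite subr_gt0.
  have : 1 `^ (1 - gamma) < n%:R `^ (1 - gamma) :> R.
    by apply: gt0_ltr_powR; rewrite ?nnegrE// ltr1n; lia.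
  by rewrite powR1.
rewrite (_ : s%:R / h%:R - t = (s%:R - t * h%:R) / h%:R); last first.
  by rewrite mulrBl mulfK// gt_eqF.
rewrite normrM normfV (gtr0_norm h0) ler_pdivrMr//.
by apply: le_trans dh _; rewrite ler_pM2r.
Qed.

Hypothesis X_ergodic : ergodic P X.
Hypothesis gamma_gt0 : 0 < gamma.

Lemma good_time_words (s : seq (seq A)) :
  \forall w \ae P, \forall n \near \oo,
    word (path_of X w) n%:Z K \in s -> good_time ordest X gamma n w.
Proof.
have := frequent_words K X_process X_stationary X_ergodic gamma_gt0 s.
move: ordest_consistent; apply: filterS2 => w; apply: filterS2 => n ordK h /h.
by rewrite /good_time ordK.
Qed.

Lemma card_good_time n w :
  #|[pred k : 'I_n | good_time ordest X gamma k w]| =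
  count (fun k => good_time ordest X gamma k w) (iota 0 n).
Proof.
rewrite -sum1_card -sum1_count big_mkcond [RHS]big_mkcond /=.
by rewrite -[in RHS](subn0 n) -/(index_iota 0 n) big_mkord.
Qed.

(** From some time n0 on, the times spent in a set of words of probability at
    least 1 - e / 2 are good; the n0 first times are absorbed by the other
    e / 2. *)
Lemma good_density (e : R) : 0 < e -> e <= 1 ->
  \forall w \ae P, \forall n \near \oo, 1 - e <= #|[pred k : 'I_n | good_time ordest X gamma k w]|%:R / n%:R.
Proof.
move=> e0 e1; have e2 : 0 < e / 2 by rewrite divr_gt0.
have [s hs] := likely_words P K X_process e2.
have ms := event_word (A := A) 0 K [set v | v \in s].
have r0 : 0 <= 1 - e / 2 by lra.
have := visits_ge_eventually X_process X_stationary X_ergodic ms r0 hs.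
move: (good_time_words s); apply: filterS2 => w [n0 _ hn0] [n1 _ hn1].
exists (n1 + (Num.truncn (n0%:R / (e / 2))).+1)%N => // n /= nN.
have npos : 0 < n%:R :> R by rewrite ltr0n; lia.
have n0n : n0%:R <= e / 2 * n%:R.
  rewrite mulrC -ler_pdivrMr// ltW// (lt_le_trans (truncnS_gt _))// ler_nat.
  by apply: leq_trans nN; exact: leq_addl.
rewrite ler_pdivlMr// card_good_time.
have := hn1 n ltac:(rewrite /=; lia).
rewrite (visits_word K (mem s)) /seg count_map.
have : (count (preim (fun k : nat => 0 + k%:Z)
      (fun i => word (path_of X w) i K \in s)) (iota 0 n))%:R <=
    n0%:R + (count (fun k => good_time ordest X gamma k w) (iota 0 n))%:R :> R.
  rewrite -natrD ler_nat; apply: count_iota_le => i n0i /=.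
  by rewrite add0r; exact: hn0.
by lra.
Qed.

Lemma good_liminf : \forall w \ae P,
  limn_einf (fun n => ((#|[pred k : 'I_n | good_time ordest X gamma k w]|%:R
    / n%:R : R)%:E)) = 1%E.
Proof.
have : \forall w \ae P, forall j : nat, \forall n \near \oo, 1 - j.+1%:R^-1 <=
    #|[pred k : 'I_n | good_time ordest X gamma k w]|%:R / n%:R :> R.
  by apply: ae_foralln => j; apply: good_density => //; rewrite invf_le1// ler1n.
apply: filterS => w dens; set u := fun n => _.
have cu : u @ \oo --> 1%E.
  apply: cvg_EFin; first exact: nearW.
  apply/cvgrPdist_le => e e0.
  have [N _ hN] := dens (Num.truncn e^-1).
  exists N => // n /= /hN /= h.
  have u1 : #|[pred k : 'I_n | good_time ordest X gamma k w]|%:R / n%:R <= 1 :> R.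
    have [->|n0] := posnP n; first by rewrite invr0 mulr0.
    by rewrite ler_pdivrMr ?ltr0n// mul1r ler_nat -[leqRHS]card_ord max_card.
  rewrite ger0_norm ?subr_ge0//.
  rewrite lerBlDr -lerBlDl; apply: le_trans _ h; rewrite lerD2l lerN2.
  by rewrite -[leRHS]invrK lef_pV2 ?posrE ?invr_gt0// ltW// truncnS_gt.
by rewrite is_cvg_limn_einfE; [apply/cvg_lim | apply/cvg_ex; exists 1%E].
Qed.

Lemma words_over (S : seq A) l : exists s : seq (seq A),
  forall v, size v = l -> {subset v <= S} -> v \in s.
Proof.
elim: l => [|l [s hs]]; first by exists [:: [::]] => v /size0nil ->.
exists [seq a :: v | a <- S, v <- s] => -[//|a v] [sv] vS.
apply: allpairs_f; first by apply: vS; rewrite mem_head.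
by apply: hs => // b bv; apply: vS; rewrite inE bv orbT.
Qed.

Lemma finite_alphabet_good (S : seq A) : (forall n w, X n w \in S) ->
  \forall w \ae P,
    finite_set ([set n : nat | (0 < n)%N] `\` good_times ordest X gamma w).
Proof.
move=> XS; have [s hs] := words_over S K.
have := good_time_words s; apply: filterS => w [N _ hN].
apply: (@sub_finite_set _ _ `I_N); last exact: finite_II.
move=> n /= [_ bad]; rewrite ltnNge; apply/negP => Nn; apply: bad.
apply: hN => //; apply: hs; first exact: size_word.
by move=> a /mapP[i _ ->]; exact: XS.
Qed.

End Conclusions.

Theorem theorem9 (d : measure_display) (T : measurableType d) (R : realType)
    (P : probability T R) (A : countType) (X : int -> T -> A) (K : nat)
    (gamma : R) (ordest : seq A -> nat)
    (X_process : process X)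
    (X_stationary : stationary P X)
    (X_ergodic : ergodic P X)
    (X_markov : markov_of_order P X K)
    (gamma_gt0 : 0 < gamma) (gamma_lt1 : gamma < 1)
    (ordest_consistent :
      \forall w \ae P, \forall n \near \oo, ordest_at ordest X n w = K) :
  [/\ forall x : A, \forall w \ae P,
        (fun n => `| q_hat ordest X n x w - next_letter_prob P X K n x w |)
          @ within (good_times ordest X gamma w) \oo --> (0 : R),
      \forall w \ae P,
        limn_einf (fun n => ((#|[pred k : 'I_n | good_time ordest X gamma k w]|%:R
                              / n%:R : R)%:E)) = 1%E
    & (exists S : seq A, forall n w, X n w \in S) ->
      \forall w \ae P,
        finite_set ([set n : nat | (0 < n)%N] `\` good_times ordest X gamma w)].
Proof.
split.
- move=> x; apply: q_hat_cvg => //; first by case: X_markov.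
  by rewrite subr_gt0.
- exact: (good_liminf X_process X_stationary ordest_consistent X_ergodic
    gamma_gt0).
- case=> S XS; exact: (finite_alphabet_good X_process X_stationary
    ordest_consistent X_ergodic gamma_gt0 XS).
Qed.
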